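(* Let $\mathrm{N}(f_n)$ denote the number of pairwise nonisomorphic leaf-induced subtrees of the leaf-Fibonacci tree $f_n$. There exist positive constants $K_1,K_2>0$ such that $$\mathrm{N}(f_n)=(1+o(1))\,K_1\cdot K_2^{\left(\frac{1+\sqrt5}{2}\right)^n}\quad\text{as } n\to\infty.$$
   Context: A topological tree is a rooted tree with no vertex of outdegree $1$. The leaf-Fibonacci trees are defined recursively: $f_0$ is the tree with a single vertex; $f_1$ is the tree consisting of a root with two leaves attached; for $n\ge 2$, $f_n$ is obtained by joining the roots of $f_{n-1}$ and $f_{n-2}$ to a new common root vertex. For a topological tree $T$ and a nonempty set $L$ of leaves of $T$, the subtree induced by $L$ is obtained by taking the minimal subtree of $T$ containing all leaves in $L$ (rooted at its vertex closest to the root of $T$) and suppressing all vertices of outdegree $1$; such trees are called leaf-induced subtrees of $T$ (the one-vertex tree is included). Two rooted trees are isomorphic if there is a graph isomorphism between them mapping root to root. *)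

(* Defs.v *)
From HB Require Import structures.
From mathcomp Require Import all_boot.

Set Implicit Arguments.
Unset Strict Implicit.
Unset Printing Implicit Defensive.

(* Raw data of a finite rooted tree with edges oriented away from the root.
   The vertices form a subset of an ambient finType, so that a tree and the
   trees obtained from it by deleting or suppressing vertices share the same
   ambient type. Being a tree is the separate predicate is_rooted_tree. *)
Record rtree := RTree {
  ambient : finType;
  verts : {set ambient};
  arc : rel ambient;
  root : ambient
}.

Section Rtree.
Variable T : rtree.
Implicit Types (u v w : ambient T) (L S : {set ambient T}).

Definition adj : rel (ambient T) := [rel u v | arc u v || arc v u].

Definition children v := [set w in verts T | arc v w].
Definition outdeg v := #|children v|.

Definition leaves := [set v in verts T | outdeg v == 0].

Definition is_rooted_tree : Prop :=
  [/\ root T \in verts T,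
      forall u v, arc u v -> u \in verts T /\ v \in verts T,
      forall u, ~~ arc u (root T),
      forall u v w, arc u w -> arc v w -> u = v &
      forall v, v \in verts T -> connect (@arc T) (root T) v].

Definition is_topological_tree : Prop :=
  is_rooted_tree /\ forall v, v \in verts T -> outdeg v != 1.

Definition connected_in S :=
  [forall u in S, forall v in S,
    connect [rel x y | [&& x \in S, y \in S & adj x y]] u v].

(* In a tree an intersection of connected vertex sets is connected, so span L
   is the vertex set of the minimal subtree containing L. *)
Definition span L : {set ambient T} :=
  \bigcap_(S : {set ambient T} |
      [&& L \subset S, S \subset verts T & connected_in S]) S.

(* In a rooted tree the number of proper ancestors of v is the distance from
   the root to v. *)
Definition depth v := #|[set u | connect (@arc T) u v & u != v]|.

(* The default value of the arg min is irrelevant as soon as span L is not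
   empty. *)
Definition minimal_subtree L : rtree :=
  {| ambient := ambient T;
     verts := span L;
     arc := [rel u v | [&& u \in span L, v \in span L & arc u v]];
     root := [arg min_(v < root T in span L) depth v] |}.

Definition unary := [set v in verts T | outdeg v == 1].

(* After suppression there is an arc from u to v when T has a directed path
   from u to v whose interior vertices are all suppressed. *)
Definition suppress : rtree :=
  {| ambient := ambient T;
     verts := verts T :\: unary;
     arc := [rel u v | [&& u \in verts T :\: unary, v \in verts T :\: unary &
               [exists x, connect [rel y z | arc y z && (z \in unary)] u x
                          && arc x v]]];
     root := root T |}.

End Rtree.

Definition leaf_induced (T : rtree) (L : {set ambient T}) : rtree :=
  suppress (minimal_subtree L).

Definition isomorphic (T1 T2 : rtree) : bool :=
  [exists f : {ffun ambient T1 -> ambient T2},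
    [&& f @: verts T1 == verts T2, dinjectiveb f (verts T1),
        f (root T1) == root T2 &
        [forall u in verts T1, forall v in verts T1,
           adj (f u) (f v) == adj u v]]].

(* Number of isomorphism classes of leaf-induced subtrees of T. *)
Definition num_leaf_induced (T : rtree) : nat :=
  #|equivalence_partition
      (fun L L' : {set ambient T} =>
         isomorphic (leaf_induced L) (leaf_induced L'))
      [set L in powerset (leaves T) | L != set0]|.

Definition point : rtree :=
  {| ambient := unit; verts := setT; arc := fun _ _ => false; root := tt |}.

Definition join (T1 T2 : rtree) : rtree :=
  {| ambient := option (ambient T1 + ambient T2);
     verts := [set x | match x with
                       | None => true
                       | Some (inl v) => v \in verts T1
                       | Some (inr v) => v \in verts T2
                       end];
     arc := fun x y => match x, y with
                       | None, Some (inl v) => v == root T1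
                       | None, Some (inr v) => v == root T2
                       | Some (inl u), Some (inl v) => arc u v
                       | Some (inr u), Some (inr v) => arc u v
                       | _, _ => false
                       end;
     root := None |}.

Fixpoint leaf_fibonacci (n : nat) : rtree :=
  match n with
  | 0 => point
  | 1 => join point point
  | (m.+1 as k).+1 => join (leaf_fibonacci k) (leaf_fibonacci m)
  end.

Lemma join_rooted (T1 T2 : rtree) :
  is_rooted_tree T1 -> is_rooted_tree T2 -> is_rooted_tree (join T1 T2).
Proof.
move=> [r1 a1 n1 u1 c1] [r2 a2 n2 u2 c2]; split => /=.
- by rewrite inE.
- move=> [[u|u]|] [[v|v]|] //=; rewrite !inE //.
  + by move/a1.
  + by move/a2.
  + by move/eqP->.
  + by move/eqP->.
- by move=> [[u|u]|].
- move=> [[u|u]|] [[v|v]|] [[w|w]|] //=.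
  + by move=> h1 h2; rewrite (u1 _ _ _ h1 h2).
  + by move=> h /eqP e; move: h; rewrite e (negPf (n1 _)).
  + by move=> h1 h2; rewrite (u2 _ _ _ h1 h2).
  + by move=> h /eqP e; move: h; rewrite e (negPf (n2 _)).
  + by move=> /eqP -> h; move: (n1 v); rewrite h.
  + by move=> /eqP -> h; move: (n2 v); rewrite h.
- move=> v0 v0V; set J := join T1 T2.
  have HL p (x : ambient T1) : path (@arc T1) x p ->
      connect (@arc J) (Some (inl x)) (Some (inl (last x p))).
    elim: p x => [|y p IH] x /=; first by rewrite connect0.
    by case/andP=> xy /IH; apply: connect_trans; exact: connect1.
  have HR p (x : ambient T2) : path (@arc T2) x p ->
      connect (@arc J) (Some (inr x)) (Some (inr (last x p))).
    elim: p x => [|y p IH] x /=; first by rewrite connect0.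
    by case/andP=> xy /IH; apply: connect_trans; exact: connect1.
  case: v0 v0V => [[v|v]|]; rewrite ?inE.
  + case/c1/connectP=> p /HL pp ->; apply: connect_trans pp.
    by apply: connect1 => /=; exact: eqxx.
  + case/c2/connectP=> p /HR pp ->; apply: connect_trans pp.
    by apply: connect1 => /=; exact: eqxx.
  + by move=> _; exact: connect0.
Qed.

Lemma join_topological (T1 T2 : rtree) :
  is_topological_tree T1 -> is_topological_tree T2 ->
  is_topological_tree (join T1 T2).
Proof.
move=> [t1 d1] [t2 d2]; split; first exact: join_rooted.
have [r1 _ _ _ _] := t1; have [r2 _ _ _ _] := t2.
move=> [[v|v]|]; rewrite inE.
- move=> /d1; rewrite /outdeg; congr (_ != _).
  have inj : injective (fun w => Some (inl w) : ambient (join T1 T2)).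
    by move=> ? ? [].
  rewrite -(card_imset _ inj); congr #|pred_of_set _|.
  apply/esym/setP => -[[w|w]|].
  + apply/idP/imsetP => [|[x xc [->]]]; last by move: xc; rewrite !inE.
    by rewrite !inE => wc; exists w; rewrite ?inE.
  + by apply/idP/imsetP => [|[]//]; rewrite !inE ?andbF.
  + by apply/idP/imsetP => [|[]//]; rewrite !inE ?andbF.
- move=> /d2; rewrite /outdeg; congr (_ != _).
  have inj : injective (fun w => Some (inr w) : ambient (join T1 T2)).
    by move=> ? ? [].
  rewrite -(card_imset _ inj); congr #|pred_of_set _|.
  apply/esym/setP => -[[w|w]|].
  + by apply/idP/imsetP => [|[]//]; rewrite !inE ?andbF.
  + apply/idP/imsetP => [|[x xc [->]]]; last by move: xc; rewrite !inE.
    by rewrite !inE => wc; exists w; rewrite ?inE.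
  + by apply/idP/imsetP => [|[]//]; rewrite !inE ?andbF.
- move=> _; rewrite /outdeg.
  suff -> : children (None : ambient (join T1 T2)) =
            [set Some (inl (root T1)); Some (inr (root T2))] by rewrite cards2.
  apply/setP => -[[w|w]|]; rewrite !inE //=.
  + by rewrite orbF; apply/andP/eqP => [[_ /eqP->]|[->]].
  + by apply/andP/eqP => [[_ /eqP->]|[->]].
Qed.

Lemma leaf_fibonacci_topological (n : nat) :
  is_topological_tree (leaf_fibonacci n).
Proof.
have P0 : is_topological_tree point.
  split; first by split=> [||||[] _] //; rewrite ?inE // connect0.
  move=> v _; rewrite /outdeg; suff -> : children v = set0 by rewrite cards0.
  by apply/setP=> w; rewrite !inE.
suff [] : is_topological_tree (leaf_fibonacci n) /\
          is_topological_tree (leaf_fibonacci n.+1) by [].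
elim: n => [|n [IH IH']]; first by split=> //; exact: join_topological.
by split=> //; exact: join_topological.
Qed.

(* Main.v *)
(** Write [N n] for the number of leaf-induced subtrees of [f_n]. A set of leaves
    of a join of two trees meets one of the two branches, or both; in the last
    case the induced subtree is the join of the two induced subtrees. As [f_n]
    is a branch of [f_(n+1)], the trees obtained as a join of one induced by
    [f_(n+1)] but not by [f_n] and one induced by [f_n] are pairwise distinct,
    so
      [N n * (N (n+1) - N n) <= N (n+2) <= N n * N (n+1) + N n + N (n+1)].
    Hence [N n / N (n+1)] tends to [0] and [N (n+2) / (N (n+1) * N n)] tends to
    [1], so that [ln (N n)] satisfies the Fibonacci recurrence up to an error
    [e n] tending to [0]. With [phi] and [psi] the golden ratio and its
    conjugate, [ln (N n) - psi * ln (N (n-1))] is [B * phi ^ n + o(1)] because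
    [phi > 1], and then [ln (N n) = c * phi ^ n + o(1)] because [|psi| < 1].
    Thus [K1 = 1] and [K2 = exp c]. *)

From mathcomp Require Import all_boot zify.
Require Import Defs.

Set Implicit Arguments.
Unset Strict Implicit.
Unset Printing Implicit Defensive.

(** * Leaf-induced subtrees of a rooted tree *)

Lemma connect_last (T : finType) (e : rel T) x y :
  connect e x y -> x = y \/ exists2 z, connect e x z & e z y.
Proof.
case/connectP=> p; case/lastP: p => [|p z] /=; first by move=> _ ->; left.
rewrite rcons_path last_rcons => /andP[xp ez] ->; right.
by exists (last x p) => //; apply/connectP; exists p.
Qed.

Lemma connect_first (T : finType) (e : rel T) x y :
  connect e x y -> x = y \/ exists2 z, e x z & connect e z y.
Proof.
case/connectP=> -[_ ->|z p /= /andP[xz zp] ->]; first by left.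
by right; exists z => //; apply/connectP; exists p.
Qed.

Section Ancestors.
Variables (T : rtree) (rtT : is_rooted_tree T).
Implicit Types (u v w x : ambient T) (L S : {set ambient T}).

Definition anc u v := connect (@arc T) u v.

Lemma anc_refl u : anc u u. Proof. exact: connect0. Qed.

Lemma anc_trans v u w : anc u v -> anc v w -> anc u w.
Proof. exact: connect_trans. Qed.

Lemma arc_anc u v : arc u v -> anc u v.
Proof. exact: connect1. Qed.

(** Induction on the path from the root to [x]. Parents are unique, so a path from [y] back to [x]
    would put the parent of [x] below [x], against the induction hypothesis for the arc entering
    [x]; the root has no parent. *)
Lemma arc_acyclic x y : arc x y -> ~~ anc y x.
Proof.
have [_ aV nr par con] := rtT.
move=> xy; have [xV _] := aV _ _ xy.
case/connectP: (con _ xV) => p.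
elim/last_ind: p x y xy {xV} => [|p z IH] x y xy.
  move=> _ /= ex; apply/negP => /connect_last[yr|[w _]].
    by move: xy; rewrite yr ex (negPf (nr _)).
  by rewrite ex (negPf (nr _)).
rewrite rcons_path last_rcons => /andP[rp wz] ex; rewrite {}ex {x} in xy *.
apply/negP => yz; have /negP := IH _ _ wz rp (erefl _); apply.
case/connect_last: yz => [ey|[w yw wz']].
  by rewrite ey in xy; rewrite {1}(par _ _ _ wz xy) anc_refl.
by rewrite -(par _ _ _ wz' wz); apply: anc_trans yw; exact: arc_anc.
Qed.

Lemma anc_anti u v : anc u v -> anc v u -> u = v.
Proof.
case/connect_first=> [//|[w uw wv]] vu.
by case/negP: (arc_acyclic uw); exact: anc_trans wv vu.
Qed.

Lemma anc_arc u x y : arc y x -> anc u x -> u = x \/ anc u y.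
Proof.
have [_ _ _ up _] := rtT.
by move=> yx /connect_last[|[w uw wx]]; [left | right; rewrite (up _ _ _ yx wx)].
Qed.

(** Climb from [x] towards [u] through unique parents: at each stage [v] is either the current
    vertex, hence below [u], or an ancestor of its parent. *)
Lemma anc_total u v x : anc u x -> anc v x -> anc u v || anc v u.
Proof.
move=> + vx; case/connectP=> p; elim/last_ind: p x vx => [|p z IH] x vx.
  by move=> _ /= ex; rewrite -ex vx orbT.
rewrite rcons_path last_rcons => /andP[up wz] ex; rewrite {}ex {x} in vx *.
case: (anc_arc wz vx) => [->|vw]; last exact: IH vw up _.
apply/orP; left; apply: anc_trans (arc_anc wz).
by apply/connectP; exists p.
Qed.

Lemma anc_verts u v : v \in verts T -> anc u v -> u \in verts T.
Proof.
have [_ aV _ _ _] := rtT.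
by move=> vV /connect_first[->//|[w uw _]]; case: (aV _ _ uw).
Qed.

Lemma leaf_anc l v : l \in leaves T -> anc l v -> v = l.
Proof.
have [_ aV _ _ _] := rtT.
rewrite inE cards_eq0 => /andP[_ /eqP l0] /connect_first[//|[w lw _]].
have [_ wV] := aV _ _ lw.
by have : w \in children l; [rewrite inE wV | rewrite l0 inE].
Qed.

Lemma depth_lt u v : anc u v -> u != v -> depth u < depth v.
Proof.
move=> uv nuv; apply/proper_card/properP; split.
  apply/subsetP=> w; rewrite !inE => /andP[wu nwu].
  rewrite (connect_trans wu uv) /=; apply: contraNneq nwu => wv.
  by apply/eqP/anc_anti => //; rewrite wv.
by exists u; rewrite !inE ?eqxx ?andbF //; apply/andP.
Qed.

(** Universal property of the lowest common ancestor: taking [u := r] shows that [r] is a common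
    ancestor, and the converse implication that it is the lowest one. Uniqueness then follows from
    antisymmetry. *)
Definition lca_of L r := forall u, anc u r <-> forall l, l \in L -> anc u l.

Lemma lca_anc L r l : lca_of L r -> l \in L -> anc r l.
Proof. by move=> lr; case: (lr r) => + _; apply; exact: anc_refl. Qed.

Lemma lca_uniq L r r' : lca_of L r -> lca_of L r' -> r = r'.
Proof.
by move=> lr lr'; apply: anc_anti;
  [apply/lr' => l; exact: lca_anc | apply/lr => l; exact: lca_anc].
Qed.

(** The root is a common ancestor; choose one of maximal depth. Common ancestors are pairwise
    comparable, all lying above one element of [L], so none is strictly below the chosen one without
    being deeper. *)
Lemma lca_exists L : L != set0 -> L \subset verts T -> exists r, lca_of L r.
Proof.
have [_ _ _ _ con] := rtT.
case/set0Pn=> l0 l0L /subsetP LV.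
pose common u := [forall l in L, anc u l].
have comP u : reflect (forall l, l \in L -> anc u l) (common u).
  exact: 'forall_in_idP.
have c0 : common (root T) by apply/comP=> l /LV; exact: con.
case: (arg_maxnP (@depth T) c0) => r /comP cr max; exists r => u.
split=> [ur l lL | /comP cu]; first exact: anc_trans ur (cr _ lL).
case: (eqVneq r u) => [->|nru]; first exact: anc_refl.
have /orP[//|ru] := anc_total ((comP _ cu) _ l0L) (cr _ l0L).
by have /= := max _ cu; rewrite leqNgt (depth_lt ru) // eq_sym.
Qed.

Definition up L := [set v | [exists l in L, anc v l]].

Lemma upP L v : reflect (exists2 l, l \in L & anc v l) (v \in up L).
Proof. by rewrite inE; exact: exists_inP. Qed.

Lemma up_anc L u v : anc u v -> v \in up L -> u \in up L.
Proof.
by move=> uv /upP[l lL vl]; apply/upP; exists l => //; exact: anc_trans vl.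
Qed.

(** The set [D] contains [L] and is connected, since every vertex of it is reached from [r] inside
    [D]. It remains to see that no connected set containing [L] can miss a vertex of [D]. *)
Lemma span_lca L r : L != set0 -> L \subset verts T -> lca_of L r ->
  span L = [set v in up L | anc r v].
Proof.
move=> L0 LV lr; set D := [set v in up L | _].
have LD : L \subset D.
  apply/subsetP=> l lL; rewrite inE (lca_anc lr lL) andbT.
  by apply/upP; exists l => //; exact: anc_refl.
apply/eqP; rewrite eqEsubset; apply/andP; split.
  apply: bigcap_inf; rewrite LD /=; apply/andP; split.
    apply/subsetP=> v /setIdP[/upP[l lL vl] _].
    exact: anc_verts (subsetP LV _ lL) vl.
  set e := [rel x y | [&& x \in D, y \in D & adj x y]].
  have se : symmetric e.
    move=> x y /=; rewrite andbCA.
    by congr [&& _, _ & _]; exact: orbC.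
  have rD v : v \in D -> connect e r v.
    case/setIdP=> vu /connectP[p rp ev].
    suff H x : anc r x -> path (@arc T) x p -> v = last x p -> connect e x v.
      exact: H (anc_refl r) rp ev.
    elim: p x {rp ev} => [|y p IH] x rx /=; first by move=> _ ->; exact: connect0.
    case/andP=> xy yp ev.
    have ry : anc r y by apply: anc_trans rx (arc_anc xy).
    have yu : y \in up L by apply: up_anc vu; apply/connectP; exists p.
    apply: connect_trans (IH y ry yp ev); apply: connect1 => /=.
    have yD : y \in D by apply/setIdP.
    have xD : x \in D by apply/setIdP; split=> //; exact: up_anc (arc_anc xy) yu.
    by rewrite xD yD; apply/orP; left.
  apply/forall_inP => u uD; apply/forall_inP => v vD.
  apply: connect_trans (rD _ vD); rewrite (sym_connect_sym se).
  exact: rD.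
(* If [S] misses [v], let [c] be the child of [v] towards some [l] in [L]. A walk in [S] starting at
   [l] can leave the descendants of [c] only through [v], so [c] lies above all of [L], hence above
   [r] and above [v], which is a cycle. *)
apply/bigcapsP => S /and3P[LS SV cS]; apply/subsetP=> v.
case/setIdP=> /upP[l lL vl] rv; apply: contraT => vS.
case/connect_first: vl => [evl|[c vc cl]].
  by rewrite evl (subsetP LS) in vS.
have/negP := arc_acyclic vc; case.
apply: (anc_trans _ rv); apply/lr => l' l'L.
have := forall_inP (forall_inP cS l (subsetP LS _ lL)) l' (subsetP LS _ l'L).
case/connectP=> p; elim: p l cl {lL} => [|y p IH] x cx /=; first by move=> _ ->.
case/andP=> /and3P[_ yS] /orP[xy|yx]; apply: IH.
  exact: anc_trans cx (arc_anc xy).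
case: (anc_arc yx cx) => // ecx; rewrite -ecx in yx.
by have [_ _ _ up _] := rtT; rewrite -(up _ _ _ yx vc) yS in vS.
Qed.

Definition kids L v := [set w in up L | arc v w].
(* For a set [L] of leaves these are the vertices that survive suppression: the
   elements of [L] have no kid, the other branching vertices at least two. *)
Definition branching L := [set v in up L | #|kids L v| != 1].

Section LeafInduced.
Variable L : {set ambient T}.
Hypotheses (L0 : L != set0) (Ll : L \subset leaves T).

Let LV : L \subset verts T.
Proof. by apply: (subset_trans Ll); apply/subsetP=> v; rewrite inE => /andP[]. Qed.

Lemma minimal_subtree_root : lca_of L (root (minimal_subtree L)).
Proof.
have [r lr] := lca_exists L0 LV.
have sE := span_lca L0 LV lr.
rewrite /minimal_subtree /=.
suff -> : [arg min_(v < root T in span L) depth v] = r by [].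
have rs : r \in span L.
  rewrite sE inE anc_refl andbT; have [l lL] := set0Pn _ L0.
  by apply/upP; exists l => //; exact: lca_anc lL.
have le v : v \in span L -> r != v -> depth r < depth v.
  by rewrite sE inE => /andP[_]; exact: depth_lt.
(* The default value is never returned: [r] lies in the span, and every other vertex of the span is
   strictly deeper. *)
rewrite /arg_min /extremum; case: pickP => [v|/(_ r)] /=.
  case/andP=> vs /forall_inP/(_ r rs); case: (eqVneq r v) => [->//|nrv].
  by rewrite leqNgt le.
rewrite rs /= => /negbT/negP[]; apply/forall_inP=> v vs.
by case: (eqVneq r v) => [->//|nrv]; apply/ltnW/le.
Qed.

Let r := root (minimal_subtree L).

Let spanE v : (v \in span L) = (v \in up L) && anc r v.
Proof. by rewrite (span_lca L0 LV minimal_subtree_root) inE. Qed.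

Lemma outdeg_minimal v : v \in span L ->
  @outdeg (minimal_subtree L) v = #|kids L v|.
Proof.
move=> vs; rewrite /outdeg; apply: eq_card => w; rewrite !inE /= vs /= !spanE.
move: vs; rewrite spanE => /andP[_ rv].
case vw: (arc v w); rewrite ?andbF //= !andbT.
by rewrite (anc_trans rv (arc_anc vw)) !andbT andbb inE.
Qed.

(** A vertex of [up L] outside the span lies strictly above the lowest common ancestor, so its only
    kid is its child on the way there. This is why [branching] can be defined without mentioning the
    span. *)
Lemma branching_span v : v \in branching L -> v \in span L.
Proof.
rewrite inE spanE => /andP[vu k1]; rewrite vu /=.
case/upP: (vu) => l lL vl.
have rl := lca_anc minimal_subtree_root lL.
have /orP[|//] := anc_total vl rl.
case/connect_first => [->|[c vc cr]]; first exact: anc_refl.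
case/negP: k1; apply/cards1P; exists c; apply/setP=> d.
apply/setIdP/set1P => [[/upP[l' l'L dl'] vd]|->]; last first.
  by split=> //; apply/upP; exists l => //; exact: anc_trans cr rl.
have cl' : anc c l' by apply: anc_trans cr (lca_anc minimal_subtree_root l'L).
have /orP[cd|dc] := anc_total cl' dl'.
  case: (anc_arc vd cd) => [//|cv]; by case/negP: (arc_acyclic vc).
case: (anc_arc vc dc) => [//|dv]; by case/negP: (arc_acyclic vd).
Qed.

Lemma branching_up v : v \in branching L -> v \in up L.
Proof. by rewrite inE => /andP[]. Qed.

Lemma leaf_induced_verts : verts (leaf_induced L) = branching L.
Proof.
apply/setP=> v; apply/idP/idP; rewrite /leaf_induced /= !inE /=.
  case/andP=> + vs; rewrite vs /= outdeg_minimal // => ->.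
  by move: vs; rewrite spanE inE => /andP[-> _].
move=> bv; have vb : v \in branching L by rewrite !inE.
have vs := branching_span vb; rewrite vs /= outdeg_minimal //.
by case/andP: bv => _ ->.
Qed.

Lemma leaf_induced_root : lca_of L (root (leaf_induced L)).
Proof. exact: minimal_subtree_root. Qed.

(** Suppression keeps the root unchanged, so the root has to survive it. A single kid of the lowest
    common ancestor would itself lie above all of [L], because elements of [L] are leaves. *)
Lemma leaf_induced_root_branching : root (leaf_induced L) \in branching L.
Proof.
have lr := leaf_induced_root; set x := root _ in lr *.
have [l lL] := set0Pn _ L0; have xl := lca_anc lr lL.
rewrite inE; apply/andP; split; first by apply/upP; exists l.
apply/negP => /cards1P[c kc].
have /setIdP[_ xc] : c \in kids L x by rewrite kc set11.
case/negP: (arc_acyclic xc); apply/lr => l' l'L.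
case: (connect_first (lca_anc lr l'L)) => [el'|[d xd dl']].
  have := leaf_anc (subsetP Ll _ l'L); rewrite -el' => /(_ _ (arc_anc xc)) ecx.
  by rewrite ecx; exact: anc_refl.
suff -> : c = d by [].
have : d \in kids L x by rewrite inE xd andbT; apply/upP; exists l'.
by rewrite kc inE => /eqP.
Qed.

(** Covering relation of the ancestor order, with intermediate vertices taken in [branching L]. This
    order-theoretic form of the arcs is easier to transport along embeddings than paths through
    suppressed vertices. *)
Definition cover u v :=
  [&& anc u v, u != v &
    [forall w in branching L, anc u w ==> anc w v ==> (w == u) || (w == v)]].

(** A path with suppressed interior has no surviving vertex strictly between its ends. Conversely,
    the interior vertices of the tree path from [u] to [v] lie in the span, and the covering
    condition forces them to be suppressed. *)
Lemma leaf_induced_arc u v : u \in branching L -> v \in branching L ->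
  @arc (leaf_induced L) u v = cover u v.
Proof.
move=> ub vb; have us := branching_span ub; have vs := branching_span vb.
have := leaf_induced_verts; rewrite /leaf_induced /suppress /= => ->.
rewrite ub vb /=; set un := unary _.
have unE w : w \in span L -> (w \in un) = (w \notin branching L).
  move=> ws; rewrite -leaf_induced_verts /leaf_induced /suppress /= !inE /=.
  by rewrite ws /= andbT negbK.
apply/exists_inP/idP => [[x /connectP[p pp ex] /and3P[xs _ xv]]|].
  (* Invariant along the path: its start [u] is the only surviving vertex between [u] and the
     current vertex [x]. *)
  have {pp ex} ux : anc u x /\ forall w, w \in branching L -> anc u w ->
      anc w x -> w = u.
    elim/last_ind: p x pp ex {xs xv} => [|p z IH] x; rewrite ?rcons_path ?last_rcons /=.
      by move=> _ ->; split=> [|w _ uw wu]; [exact: anc_refl | exact: anc_anti].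
    case/andP=> pp /andP[/and3P[ys zs yz] zu] ->.
    have [uy IH'] := IH _ pp (erefl _).
    split=> [|w wb uw wz]; first exact: anc_trans uy (arc_anc yz).
    case: (anc_arc yz wz) => [ewz|wy]; last exact: IH'.
    by move: zu; rewrite unE // -ewz wb.
  case: ux => ux uw; apply/and3P; split.
  - exact: anc_trans ux (arc_anc xv).
  - by apply: contraL xv => /eqP<-; apply: contraL ux => /arc_acyclic.
  apply/forall_inP => w wb; apply/implyP=> uw'; apply/implyP=> wv.
  case: (anc_arc xv wv) => [->|wx]; first by rewrite eqxx orbT.
  by rewrite (uw w) // eqxx.
case/and3P=> uv nuv /forall_inP cv.
case: (connect_last uv) => [euv|[x ux xv]]; first by rewrite euv eqxx in nuv.
have ru : anc r u by move: us; rewrite spanE => /andP[].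
have sp w : anc u w -> anc w v -> w \in span L.
  move=> uw wv; rewrite spanE (anc_trans ru uw) andbT.
  exact: up_anc wv (branching_up vb).
(* The witness [x] is the parent of [v] on the path from [u]. *)
exists x; last by rewrite /= vs sp //; exact: arc_anc.
have nxv : x != v.
  by apply: contraTneq xv => ->; apply/negP=> /arc_acyclic; rewrite anc_refl.
have {xv} xv := arc_anc xv.
case/connectP: (ux) => p; elim/last_ind: p x ux xv nxv => [|p z IH] x ux xv nxv.
  by move=> _ ->; exact: connect0.
rewrite rcons_path last_rcons => /andP[pp yz] exz; rewrite {}exz in ux xv nxv *.
set y := last u p in yz *.
have uy : anc u y by apply/connectP; exists p.
have yv : anc y v := anc_trans (arc_anc yz) xv.
have nyv : y != v by apply: contraTneq xv => <-; exact: arc_acyclic.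
apply: connect_trans (IH y uy yv nyv pp (erefl _)) _.
apply: connect1; rewrite /= !sp // yz /= unE ?sp //; apply/negP => zb.
have /implyP/(_ ux)/implyP/(_ xv)/orP[/eqP ez|/eqP ez] := cv _ zb.
  by have := arc_acyclic yz; rewrite ez uy.
by rewrite ez eqxx in nxv.
Qed.

End LeafInduced.
End Ancestors.

(** * Leaf-induced subtrees of a join *)

(** Propositional form of [isomorphic], with an explicit inverse on the vertex sets so that symmetry
    and transitivity are immediate. Having the root among the vertices makes the inverse send root
    to root. *)
Definition iso (T1 T2 : rtree) : Prop :=
  exists (f : ambient T1 -> ambient T2) (g : ambient T2 -> ambient T1),
  [/\ {in verts T1, forall x, f x \in verts T2 /\ g (f x) = x},
      {in verts T2, forall y, g y \in verts T1 /\ f (g y) = y},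
      f (root T1) = root T2, root T1 \in verts T1 &
      {in verts T1 &, forall x y, adj (f x) (f y) = adj x y}].

Lemma iso_root (T1 T2 : rtree) : iso T1 T2 -> root T1 \in verts T1.
Proof. by case=> f [g []]. Qed.

Lemma iso_sym T1 T2 : iso T1 T2 -> iso T2 T1.
Proof.
case=> f [g [fP gP fr r1 fa]]; exists g, f; split=> //.
- by rewrite -fr; case: (fP _ r1).
- by rewrite -fr; case: (fP _ r1).
move=> x y /gP[gx fgx] /gP[gy fgy].
by rewrite -{2}fgx -{2}fgy fa.
Qed.

Lemma iso_trans T2 T1 T3 : iso T1 T2 -> iso T2 T3 -> iso T1 T3.
Proof.
case=> f [g [fP gP fr r1 fa]] [h [k [hP kP hr _ ha]]].
exists (h \o f), (g \o k); split=> //=.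
- move=> x /fP[fx gfx]; have [hfx khfx] := hP _ fx.
  by rewrite khfx.
- move=> x /kP[kx hkx]; have [gkx fgkx] := gP _ kx.
  by rewrite fgkx.
- by rewrite fr.
by move=> x y xV yV; rewrite ha ?fa //; [case: (fP _ xV) | case: (fP _ yV)].
Qed.

Lemma isomorphicP T1 T2 : root T1 \in verts T1 -> isomorphic T1 T2 <-> iso T1 T2.
Proof.
move=> r1; split.
  case/existsP=> f /and4P[/eqP fV /dinjectiveP fI /eqP fr /forall_inP fa].
  (* The default is taken only outside [verts T2], which is the image of [verts T1]. *)
  pose g y := odflt (root T1) [pick x in verts T1 | f x == y].
  have gP : {in verts T2, forall y, g y \in verts T1 /\ f (g y) = y}.
    move=> y; rewrite -fV => /imsetP[x xV ->]; rewrite /g.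
    case: pickP => [z /andP[zV /eqP ez] //|/(_ x)].
    by rewrite xV eqxx.
  have fP x : x \in verts T1 -> f x \in verts T2.
    by move=> xV; rewrite -fV; apply: imset_f.
  exists f, g; split=> //.
    move=> x xV; split; first exact: fP.
    by have [gV fgE] := gP _ (fP _ xV); apply: fI.
  by move=> x y xV yV; apply/eqP; exact: (forall_inP (fa x xV)).
case=> f [g [fP gP fr _ fa]]; apply/existsP; exists (finfun f).
apply/and4P; split.
- apply/eqP/setP=> y; apply/imsetP/idP => [[x xV ->]|yV].
    by rewrite ffunE; case: (fP _ xV).
  by case: (gP _ yV) => gy fgy; exists (g y); rewrite ?ffunE.
- apply/dinjectiveP=> x y xV yV; rewrite !ffunE => e.
  by case: (fP _ xV) => _ <-; case: (fP _ yV) => _ <-; rewrite e.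
- by rewrite ffunE fr.
apply/forall_inP => x xV; apply/forall_inP => y yV; rewrite !ffunE.
by apply/eqP; exact: fa.
Qed.

Lemma iso_join A B C D : iso A C -> iso B D -> iso (join A B) (join C D).
Proof.
move=> [f [g [fP gP fr rA fa]]] [h [k [hP kP hr rB ha]]].
pose m (X Y Z W : Type) (p : X -> Y) (q : Z -> W) (x : option (X + Z)) :=
  match x with
  | None => None | Some (inl x) => Some (inl (p x))
  | Some (inr x) => Some (inr (q x)) end.
exists (m _ _ _ _ f h), (m _ _ _ _ g k); split=> //=.
- move=> [[x|x]|]; rewrite !inE //=.
    by case/fP=> -> ->.
  by case/hP=> -> ->.
- move=> [[x|x]|]; rewrite !inE //=.
    by case/gP=> -> ->.
  by case/kP=> -> ->.
- by rewrite inE.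
have fe x : x \in verts A -> (f x == root C) = (x == root A).
  move=> xV; apply/eqP/eqP=> [|->//]; rewrite -fr => e.
  by case: (fP _ xV) => _ <-; rewrite e; case: (fP _ rA).
have he x : x \in verts B -> (h x == root D) = (x == root B).
  move=> xV; apply/eqP/eqP=> [|->//]; rewrite -hr => e.
  by case: (hP _ xV) => _ <-; rewrite e; case: (hP _ rB).
move=> [[x|x]|] [[y|y]|]; rewrite !inE /adj //= => xV yV; rewrite ?orbF ?fe ?he //.
  exact: fa.
exact: ha.
Qed.

Lemma iso_joinC A B : root A \in verts A -> root B \in verts B ->
  iso (join A B) (join B A).
Proof.
move=> rA rB.
pose m (X Y : Type) (x : option (X + Y)) : option (Y + X) :=
  match x with
  | None => None | Some (inl x) => Some (inr x)
  | Some (inr x) => Some (inl x) end.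
exists (m _ _), (m _ _); split=> //=.
- by move=> [[x|x]|]; rewrite !inE.
- by move=> [[x|x]|]; rewrite !inE.
- by rewrite inE.
by move=> [[x|x]|] [[y|y]|].
Qed.

Section Embedding.
Variables (T1 T : rtree) (i : ambient T1 -> ambient T).
Hypotheses (rt1 : is_rooted_tree T1) (rt : is_rooted_tree T).

(* [i] identifies [T1] with the set of all descendants of a vertex of [T]. *)
Definition down_embedding : Prop :=
  [/\ injective i, forall u, (i u \in verts T) = (u \in verts T1),
      forall u v, arc (i u) (i v) = arc u v &
      forall u x, arc (i u) x -> exists v, x = i v].

Hypothesis iP : down_embedding.

Lemma embed_inj : injective i. Proof. by case: iP. Qed.

Lemma embed_anc_codom u x : anc (i u) x -> exists2 v, x = i v & anc u v.
Proof.
case: iP => _ _ ia ic /connectP[p]; elim: p u => [|y p IH] u /=.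
  by move=> _ ->; exists u => //; exact: anc_refl.
case/andP=> uy; have [v ey] := ic _ _ uy; rewrite {}ey ia in uy *.
move=> /IH/[apply] -[w -> vw]; exists w => //.
exact: anc_trans (arc_anc uy) vw.
Qed.

Lemma embed_anc u v : anc (i u) (i v) = anc u v.
Proof.
apply/idP/idP; first by case/embed_anc_codom=> w /embed_inj->.
case: iP => _ _ ia ic /connectP[p]; elim: p u => [|y p IH] u /=.
  by move=> _ ->; exact: anc_refl.
case/andP=> uy /IH/[apply]; apply: anc_trans.
by apply: arc_anc; rewrite ia.
Qed.

Variable L : {set ambient T}.
Let L1 := i @^-1: L.

Lemma embed_up u : (i u \in up L) = (u \in up L1).
Proof.
apply/upP/upP => [[l lL /embed_anc_codom[v el uv]]|[l lL ul]].
  by exists v; rewrite // inE -el.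
by exists (i l); rewrite ?embed_anc //; move: lL; rewrite inE.
Qed.

Lemma embed_kids u : kids L (i u) = i @: kids L1 u.
Proof.
case: iP => _ _ ia ic; apply/setP=> x; apply/setIdP/imsetP.
  case=> xu ux; have [v ex] := ic _ _ ux; exists v => //.
  by apply/setIdP; rewrite -embed_up -ex -(ia u) -ex.
by case=> v /setIdP[vu uv] ->; rewrite embed_up ia.
Qed.

Lemma embed_branching u : (i u \in branching L) = (u \in branching L1).
Proof.
apply/setIdP/setIdP; rewrite embed_up embed_kids card_imset //; exact: embed_inj.
Qed.

Lemma embed_cover u v : cover L (i u) (i v) = cover L1 u v.
Proof.
rewrite /cover embed_anc (inj_eq embed_inj); congr [&& _, _ & _].
apply/forall_inP/forall_inP => H w wb.
  by have := H (i w); rewrite embed_branching wb !embed_anc !(inj_eq embed_inj) => ->.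
apply/implyP=> uw; have [z ez _] := embed_anc_codom uw.
rewrite ez embed_anc in uw; rewrite ez embed_anc !(inj_eq embed_inj).
by apply: (implyP (H z _)); rewrite // -embed_branching -ez.
Qed.

Lemma embed_leaves u : (i u \in leaves T) = (u \in leaves T1).
Proof.
case: iP => ij iV ia ic; rewrite !inE iV; congr (_ && (_ == 0)).
rewrite /outdeg -(card_imset _ ij); apply: eq_card => x.
apply/setIdP/imsetP => [[xV ux]|[v /setIdP[vV uv] ->]]; last by rewrite iV ia.
by have [v ex] := ic _ _ ux; exists v => //; apply/setIdP; rewrite -iV -ia -ex.
Qed.

Hypotheses (L0 : L1 != set0) (Ll : L \subset leaves T).
Hypothesis Li : L \subset codom i.

(** Kids, surviving vertices and covers depend only on what lies below a vertex, so [i] preserves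
    them; as [L] is in the image of [i], all surviving vertices are too. *)
Lemma iso_leaf_induced_embed : iso (leaf_induced L1) (leaf_induced L).
Proof.
have Ll1 : L1 \subset leaves T1.
  by apply/subsetP=> l; rewrite inE => /(subsetP Ll); rewrite embed_leaves.
have L0' : L != set0.
  by have [l] := set0Pn _ L0; rewrite inE => lL; apply/set0Pn; exists (i l).
pose r1 : ambient T1 := root (leaf_induced L1).
have lr1 : lca_of L1 r1 := leaf_induced_root rt1 L0 Ll1.
(* A common ancestor of [L] is comparable with [i r1]; if it lies below, it is in the image of [i]
   and the universal property in [T1] applies. *)
have lr : lca_of L (i r1).
  move=> u; split=> [ur l lL|uL].
    have /codomP[l1 el] := subsetP Li _ lL; rewrite el in lL *.
    by apply: anc_trans ur _; rewrite embed_anc; apply: (lca_anc lr1); rewrite inE.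
  have [l] := set0Pn _ L0; rewrite inE => lL.
  have rl : anc (i r1) (i l) by rewrite embed_anc; apply: (lca_anc lr1); rewrite inE.
  have /orP[//|ru] := anc_total rt (uL _ lL) rl.
  have [v eu _] := embed_anc_codom ru; rewrite eu embed_anc; apply/lr1=> l1.
  by rewrite inE => /uL; rewrite eu embed_anc.
have er : (root (leaf_induced L) : ambient T) = i r1.
  exact (lca_uniq rt (leaf_induced_root rt L0' Ll) lr).
pose g y := odflt r1 [pick x | i x == y].
have gi x : g (i x) = x.
  rewrite /g; case: pickP => [z /eqP/embed_inj//|/(_ x)]; by rewrite eqxx.
have LV : L \subset verts T.
  by apply: (subset_trans Ll); apply/subsetP=> v /setIdP[].
exists i, g; rewrite !leaf_induced_verts //; split=> //=.
- by move=> x xb; rewrite embed_branching gi.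
- move=> y yb; have := branching_span rt L0' Ll yb.
  rewrite (span_lca rt L0' LV lr) => /setIdP[_ /embed_anc_codom[v ey _]].
  by rewrite ey gi -embed_branching -ey.
- exact: leaf_induced_root_branching.
have aE x y : x \in branching L1 -> y \in branching L1 ->
    @arc (leaf_induced L) (i x) (i y) = @arc (leaf_induced L1) x y.
  move=> xb yb; rewrite (leaf_induced_arc rt L0' Ll) ?embed_branching //.
  by rewrite (leaf_induced_arc rt1 L0 Ll1) // embed_cover.
by move=> x y xb yb; exact: f_equal2 (aE _ _ xb yb) (aE _ _ yb xb).
Qed.

End Embedding.

Lemma join_down_l T1 T2 : @down_embedding T1 (join T1 T2) (fun u => Some (inl u)).
Proof.
split=> [? ? [] //|u|//|u [[x|x]|] //=]; first by rewrite inE.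
by exists x.
Qed.

Lemma join_down_r T1 T2 : @down_embedding T2 (join T1 T2) (fun u => Some (inr u)).
Proof.
split=> [? ? [] //|u|//|u [[x|x]|] //=]; first by rewrite inE.
by exists x.
Qed.

Section LeafInducedJoin.
Variables (T1 T2 : rtree).
Hypotheses (rt1 : is_rooted_tree T1) (rt2 : is_rooted_tree T2).
Let T := join T1 T2.
Let il (u : ambient T1) : ambient T := Some (inl u).
Let ir (u : ambient T2) : ambient T := Some (inr u).
Variable L : {set ambient T}.
Let L1 := il @^-1: L.
Let L2 := ir @^-1: L.
Hypotheses (L10 : L1 != set0) (L20 : L2 != set0) (Ll : L \subset leaves T).

Let rt : is_rooted_tree T := join_rooted rt1 rt2.
Let dl : down_embedding il := join_down_l T1 T2.
Let dr : down_embedding ir := join_down_r T1 T2.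

(** The new root [None] is the lowest common ancestor and survives because it has one kid in each
    branch. Both trees have the same ambient type, and the identity is an isomorphism between
    them. *)
Lemma iso_leaf_induced_join :
  iso (join (leaf_induced L1) (leaf_induced L2)) (leaf_induced L).
Proof.
have Ll1 : L1 \subset leaves T1.
  by apply/subsetP=> l; rewrite inE => /(subsetP Ll); rewrite (embed_leaves dl).
have Ll2 : L2 \subset leaves T2.
  by apply/subsetP=> l; rewrite inE => /(subsetP Ll); rewrite (embed_leaves dr).
have L0 : L != set0.
  by have [l] := set0Pn _ L10; rewrite inE => lL; apply/set0Pn; exists (il l).
have [l1] := set0Pn _ L10; rewrite inE => l1L.
have [l2] := set0Pn _ L20; rewrite inE => l2L.
pose r1 : ambient T1 := root (leaf_induced L1).
have lr1 : lca_of L1 r1 := leaf_induced_root rt1 L10 Ll1.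
pose r2 : ambient T2 := root (leaf_induced L2).
have lr2 : lca_of L2 r2 := leaf_induced_root rt2 L20 Ll2.
have N1 (v : ambient T1) : v \in verts T1 -> @anc T None (il v).
  by move=> vV; case: rt => _ _ _ _; apply; rewrite inE.
have N2 (v : ambient T2) : v \in verts T2 -> @anc T None (ir v).
  by move=> vV; case: rt => _ _ _ _; apply; rewrite inE.
have V1 (v : ambient T1) : v \in branching L1 -> v \in verts T1.
  case/setIdP=> /upP[l /(subsetP Ll1)/setIdP[lV _] vl] _.
  exact (anc_verts rt1 lV vl).
have V2 (v : ambient T2) : v \in branching L2 -> v \in verts T2.
  case/setIdP=> /upP[l /(subsetP Ll2)/setIdP[lV _] vl] _.
  exact (anc_verts rt2 lV vl).
have lN u : anc (il u) None = false.
  by apply/negP=> /(embed_anc_codom dl)[].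
have rN u : anc (ir u) None = false.
  by apply/negP=> /(embed_anc_codom dr)[].
have lr' u v : anc (il u) (ir v) = false.
  by apply/negP=> /(embed_anc_codom dl)[].
have rl' u v : anc (ir u) (il v) = false.
  by apply/negP=> /(embed_anc_codom dr)[].
have lN' : @lca_of T L None.
  case=> [[u|u]|]; rewrite ?lN ?rN; split=> // H.
  - by have := H _ l2L; rewrite -/(ir l2) lr'.
  - by have := H _ l1L; rewrite -/(il l1) rl'.
  - move=> l lL; case: rt => _ _ _ _; apply.
    by have /setIdP[] := subsetP Ll _ lL.
  - exact: anc_refl.
have Nb : (None : ambient T) \in branching L.
  apply/setIdP; split; first by apply/upP; exists (il l1); [|exact (lca_anc lN' l1L)].
  suff -> : kids L (None : ambient T) = [set il (root T1); ir (root T2)].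
    by rewrite cards2.
  apply/setP=> x; apply/setIdP/set2P => [[_]|].
    by case: x => [[x|x]|] //= /eqP->; [left | right].
  have rc1 : forall v, v \in verts T1 -> anc (root T1) v by case: rt1.
  have rc2 : forall v, v \in verts T2 -> anc (root T2) v by case: rt2.
  case=> -> /=; split=> //; rewrite ?eqxx //.
    rewrite (embed_up dl); apply/upP; exists l1; rewrite ?inE //.
    by apply: rc1; have /(subsetP Ll1)/setIdP[] : l1 \in L1 by rewrite inE.
  rewrite (embed_up dr); apply/upP; exists l2; rewrite ?inE //.
  by apply: rc2; have /(subsetP Ll2)/setIdP[] : l2 \in L2 by rewrite inE.
have r1b : r1 \in branching L1 by exact: leaf_induced_root_branching.
have r2b : r2 \in branching L2 by exact: leaf_induced_root_branching.
have rle1 v : v \in branching L1 -> anc r1 v.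
  have LV : L1 \subset verts T1.
    by apply: (subset_trans Ll1); apply/subsetP=> ? /setIdP[].
  move/(branching_span rt1 L10 Ll1); rewrite (span_lca rt1 L10 LV lr1).
  by case/setIdP.
have rle2 v : v \in branching L2 -> anc r2 v.
  have LV : L2 \subset verts T2.
    by apply: (subset_trans Ll2); apply/subsetP=> ? /setIdP[].
  move/(branching_span rt2 L20 Ll2); rewrite (span_lca rt2 L20 LV lr2).
  by case/setIdP.
(* All surviving vertices of the first branch lie below [r1], so [r1] is the only one of them
   covered by the new root. *)
have cN1 v : v \in branching L1 -> cover L None (il v) = (v == r1).
  move=> vb; apply/and3P/eqP => [[_ _ /forall_inP]|->].
    move/(_ (il r1)); rewrite (embed_branching dl) r1b => /(_ isT).
    rewrite N1 ?V1 //= (embed_anc dl) rle1 //= (inj_eq (embed_inj dl)).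
    by move/eqP.
  split=> //; first by rewrite N1 ?V1.
  apply/forall_inP => -[[w|w]|]; last by rewrite eqxx !implybT.
    2: by rewrite -/(ir w) rl' implybT.
  rewrite (embed_branching dl) (embed_anc dl) => wb; apply/implyP=> _.
  apply/implyP=> wr; apply/orP; right; apply/eqP.
  by rewrite (anc_anti rt1 wr (rle1 _ wb)).
have cN2 v : v \in branching L2 -> cover L None (ir v) = (v == r2).
  move=> vb; apply/and3P/eqP => [[_ _ /forall_inP]|->].
    move/(_ (ir r2)); rewrite (embed_branching dr) r2b => /(_ isT).
    rewrite N2 ?V2 //= (embed_anc dr) rle2 //= (inj_eq (embed_inj dr)).
    by move/eqP.
  split=> //; first by rewrite N2 ?V2.
  apply/forall_inP => -[[w|w]|]; last by rewrite eqxx !implybT.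
    1: by rewrite -/(il w) lr' implybT.
  rewrite (embed_branching dr) (embed_anc dr) => wb; apply/implyP=> _.
  apply/implyP=> wr; apply/orP; right; apply/eqP.
  by rewrite (anc_anti rt2 wr (rle2 _ wb)).
have VE : verts (join (leaf_induced L1) (leaf_induced L2)) = branching L.
  apply/setP=> -[[v|v]|]; rewrite [LHS]inE ?Nb //.
    by rewrite (embed_branching dl) leaf_induced_verts.
  by rewrite (embed_branching dr) leaf_induced_verts.
have aE (x y : ambient T) : x \in branching L -> y \in branching L ->
    @arc (leaf_induced L) x y = @arc (join (leaf_induced L1) (leaf_induced L2)) x y.
  move=> xb yb; rewrite (leaf_induced_arc rt L0 Ll xb yb).
  case: x y xb yb => [[x|x]|] [[y|y]|].
  - rewrite !(embed_branching dl) (embed_cover dl) => xb yb.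
    by rewrite -(leaf_induced_arc rt1 L10 Ll1).
  - by rewrite /cover lr'.
  - by rewrite /cover lN.
  - by rewrite /cover rl'.
  - rewrite !(embed_branching dr) (embed_cover dr) => xb yb.
    by rewrite -(leaf_induced_arc rt2 L20 Ll2).
  - by rewrite /cover rN.
  - by rewrite (embed_branching dl) => _; exact: cN1.
  - by rewrite (embed_branching dr) => _; exact: cN2.
  - by rewrite /cover eqxx andbF.
have rE : (root (leaf_induced L) : ambient T) = None.
  exact (lca_uniq rt (leaf_induced_root rt L0 Ll) lN').
exists id, id; rewrite VE leaf_induced_verts //; split=> //=.
by move=> x y xb yb; exact: f_equal2 (aE _ _ xb yb) (aE _ _ yb xb).
Qed.

End LeafInducedJoin.

(** * Isomorphism classes of binary trees *)

(** Syntax for the trees built from [point] by [join]. Up to isomorphism, leaf-induced subtrees of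
    such trees are again of this form, so the counting can be done on this type. *)
Inductive bintree := Lf | Nd of bintree & bintree.

Fixpoint tree_of (s : bintree) : rtree :=
  if s is Nd a b then join (tree_of a) (tree_of b) else point.

Lemma tree_of_rooted s : is_rooted_tree (tree_of s).
Proof.
elim: s => [|a IHa b IHb]; last exact: join_rooted.
by case: (leaf_fibonacci_topological 0).
Qed.

Lemma tree_of_verts s v : v \in verts (tree_of s).
Proof. by elim: s v => [|a IHa b IHb] v; rewrite inE //; case: v => [[]|]. Qed.

Fixpoint shape (s : bintree) : {set ambient (tree_of s)} -> bintree :=
  match s with
  | Lf => fun _ => Lf
  | Nd a b => fun L =>
      let L1 := (fun u => Some (inl u)) @^-1: L in
      let L2 := (fun u => Some (inr u)) @^-1: L in
      if L1 == set0 then shape L2 else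
      if L2 == set0 then shape L1 else Nd (shape L1) (shape L2)
  end.

Lemma join_root_notin_leaves (T1 T2 : rtree) : root T1 \in verts T1 ->
  (None : ambient (join T1 T2)) \notin leaves (join T1 T2).
Proof.
move=> r1; rewrite inE; apply/nandP; right; rewrite -lt0n; apply/card_gt0P.
by exists (Some (inl (root T1))); apply/setIdP; split; [rewrite inE | exact: eqxx].
Qed.

(** One case for each test in [shape]: [iso_leaf_induced_embed] when [L] misses a branch,
    [iso_leaf_induced_join] when it meets both. The root of a join is not a leaf, so [L] lives on
    the branches. *)
Lemma leaf_induced_shape s (L : {set ambient (tree_of s)}) :
  L != set0 -> L \subset leaves (tree_of s) ->
  iso (leaf_induced L) (tree_of (shape L)).
Proof.
elim: s L => [|a IHa b IHb] L L0 Ll.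
  have rt := tree_of_rooted Lf.
  have uL v : v \in branching L.
    have [x] := set0Pn _ L0; case: v x => -[] tL.
    apply/setIdP; split; first by apply/upP; exists tt => //; exact: anc_refl.
    suff -> : kids L (tt : ambient (tree_of Lf)) = set0 by rewrite cards0.
    by apply/setP=> x; apply/setIdP; rewrite inE; case.
  exists id, id; rewrite leaf_induced_verts //; split=> //=.
  - exact: (fun x : unit => match x return x = tt with tt => erefl end).
  have a0 : @arc (leaf_induced L) tt tt = false.
    by rewrite (leaf_induced_arc rt L0 Ll) // /cover eqxx andbF.
  by move=> [] [] _ _; exact: (esym (f_equal2 orb a0 a0)).
have ra := tree_of_rooted a; have rb := tree_of_rooted b.
have rt := tree_of_rooted (Nd a b).
have dl := join_down_l (tree_of a) (tree_of b).
have dr := join_down_r (tree_of a) (tree_of b).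
rewrite /=; set L1 := _ @^-1: L; set L2 := _ @^-1: L.
have Ll1 : L1 \subset leaves (tree_of a).
  by apply/subsetP=> l; rewrite inE => /(subsetP Ll); rewrite (embed_leaves dl).
have Ll2 : L2 \subset leaves (tree_of b).
  by apply/subsetP=> l; rewrite inE => /(subsetP Ll); rewrite (embed_leaves dr).
have LN : (None : ambient (tree_of (Nd a b))) \notin L.
  apply: (contraNN (subsetP Ll _)).
  by apply: join_root_notin_leaves; exact: tree_of_verts.
case: eqP => [e1|/eqP n1].
  have Li : L \subset codom (fun u : ambient (tree_of b) =>
                               Some (inr u) : ambient (tree_of (Nd a b))).
    apply/subsetP=> -[[u|u]|] uL; last by rewrite uL in LN.
      by have : u \in L1; [rewrite inE | rewrite e1 inE].
    by apply/codomP; exists u.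
  have n2 : L2 != set0.
    have [l lL] := set0Pn _ L0; have /codomP[u eu] := subsetP Li _ lL.
    by apply/set0Pn; exists u; rewrite inE -eu.
  apply: iso_trans (IHb _ n2 Ll2); apply: iso_sym.
  exact (iso_leaf_induced_embed rb rt dr n2 Ll Li).
case: eqP => [e2|/eqP n2].
  have Li : L \subset codom (fun u : ambient (tree_of a) =>
                               Some (inl u) : ambient (tree_of (Nd a b))).
    apply/subsetP=> -[[u|u]|] uL; last by rewrite uL in LN.
      by apply/codomP; exists u.
    by have : u \in L2; [rewrite inE | rewrite e2 inE].
  apply: iso_trans (IHa _ n1 Ll1); apply: iso_sym.
  exact (iso_leaf_induced_embed ra rt dl n1 Ll Li).
apply: (@iso_trans (join (leaf_induced L1) (leaf_induced L2))).
  by apply: iso_sym; exact: iso_leaf_induced_join.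
by apply: iso_join; [exact: IHa | exact: IHb].
Qed.

(* [CodeSeq.code] is an injection of [seq nat] into [nat]; sorting makes the code
   of a join independent of the order of its branches, so that codes of binary
   trees are equal exactly when the trees are isomorphic. *)
Definition pair_code (x y : nat) := CodeSeq.code (sort leq [:: x; y]).

Fixpoint code (s : bintree) : nat :=
  if s is Nd a b then pair_code (code a) (code b) else 0.

Lemma pair_code_inj x y x' y' : pair_code x y = pair_code x' y' ->
  (x = x' /\ y = y') \/ (x = y' /\ y = x').
Proof.
move/(can_inj CodeSeq.codeK)/(perm_sortP leq_total leq_trans anti_leq) => e.
have := perm_mem e x; rewrite !inE eqxx /=.
case: (eqVneq x x') e => [-> e _|nx e /= /esym/eqP ex].
  left; split=> //; move: e; rewrite perm_cons => /perm_mem/(_ y).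
  by rewrite !inE eqxx => /esym/eqP.
right; split=> //; move: e; rewrite -ex perm_sym.
rewrite -[[:: x'; x]]/([:: x'] ++ [:: x]) perm_catC /= perm_cons.
by move/perm_mem/(_ y); rewrite !inE eqxx => /eqP.
Qed.

(** The empty sequence has code 0, so the single leaf never shares its code with a join. *)
Lemma pair_code_gt0 x y : 0 < pair_code x y.
Proof.
rewrite lt0n; apply/eqP; have -> : 0 = CodeSeq.code [::] by [].
move/(can_inj CodeSeq.codeK)/(congr1 size); by rewrite size_sort.
Qed.

Fixpoint height (s : bintree) : nat :=
  if s is Nd a b then (maxn (height a) (height b)).+1 else 0.

(* Reads the code off the abstract tree; [k] is the recursion depth, exceeding
   the height of the tree in all relevant cases. *)
Fixpoint vertex_code (T : rtree) (k : nat) (v : ambient T) : nat :=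
  if k is k'.+1 then
    CodeSeq.code (sort leq [seq vertex_code k' w | w <- enum (children v)])
  else 0.

(** Sorting cancels the different orders in which the two trees enumerate children. This serves both
    for the inclusion of a branch into a join and for isomorphisms. *)
Lemma vertex_code_eq (T1 T2 : rtree) (f : ambient T1 -> ambient T2) k v :
  {in verts T1, forall w, f w \in verts T2} ->
  {in verts T1 &, injective f} ->
  {in verts T1, forall w, children (f w) = f @: children w} ->
  v \in verts T1 -> vertex_code k (f v) = vertex_code k v.
Proof.
move=> fV fI fc; elim: k v => //= k IH v vV; congr CodeSeq.code.
apply/(perm_sortP leq_total leq_trans anti_leq).
have -> : [seq vertex_code k w | w <- enum (children v)] =
          [seq vertex_code k w | w <- [seq f w | w <- enum (children v)]].
  rewrite -map_comp; apply/eq_in_map => w; rewrite mem_enum => /setIdP[wV _].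
  by rewrite /= IH.
apply: perm_map; apply: uniq_perm; first exact: enum_uniq.
  rewrite map_inj_in_uniq ?enum_uniq // => x y.
  by rewrite !mem_enum => /setIdP[xV _] /setIdP[yV _]; exact: fI.
move=> x; rewrite mem_enum fc //; apply/imsetP/mapP.
  by case=> w wc ->; exists w; rewrite ?mem_enum.
by case=> w; rewrite mem_enum => wc ->; exists w.
Qed.

Lemma vertex_code_tree_of s k :
  height s < k -> vertex_code k (root (tree_of s)) = code s.
Proof.
elim: s k => [|a IHa b IHb] [|k] //.
  move=> _ /=; have -> : children (tt : ambient point) = set0.
    by apply/setP=> x; rewrite !inE.
  by rewrite enum_set0.
rewrite /= ltnS gtn_max => /andP[ak bk].
rewrite /pair_code; congr CodeSeq.code.
apply/(perm_sortP leq_total leq_trans anti_leq).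
pose l : ambient (tree_of (Nd a b)) := Some (inl (root (tree_of a))).
pose r : ambient (tree_of (Nd a b)) := Some (inr (root (tree_of b))).
have down (T1 : rtree) i : is_rooted_tree T1 ->
    @down_embedding T1 (tree_of (Nd a b)) i ->
    vertex_code k (i (root T1)) = vertex_code k (root T1).
  move=> [rV _ _ _ _] [ij iV ia ic].
  apply: vertex_code_eq => //.
  - by move=> x xV; rewrite iV.
  - by move=> x y _ _; exact: ij.
  move=> w wV; apply/setP=> x; apply/setIdP/imsetP.
    case=> xV wx; have [v ev] := ic _ _ wx; exists v => //.
    by apply/setIdP; rewrite -iV -ia -ev.
  by case=> v /setIdP[vV wv] ->; rewrite iV ia.
have <- : vertex_code k l = code a.
  by rewrite -(IHa _ ak); apply: down (tree_of_rooted a) (join_down_l _ _).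
have <- : vertex_code k r = code b.
  by rewrite -(IHb _ bk); apply: down (tree_of_rooted b) (join_down_r _ _).
apply: (@perm_map _ _ _ _ [:: l; r]).
apply: uniq_perm; rewrite ?enum_uniq // => x.
rewrite mem_enum !inE.
case: x => [[x|x]|] //=.
- by rewrite tree_of_verts orbF.
- by rewrite tree_of_verts.
Qed.

Lemma arc_asym (T : rtree) : is_rooted_tree T ->
  forall u v : ambient T, arc u v -> ~~ arc v u.
Proof.
by move=> rt u v /(arc_acyclic rt); apply: contra; exact: arc_anc.
Qed.

(* An isomorphism is only required to preserve undirected adjacency and the
   root; in a rooted tree this forces the orientation. *)
Lemma iso_arc (T1 T2 : rtree) (f : ambient T1 -> ambient T2) :
  is_rooted_tree T1 -> is_rooted_tree T2 ->
  {in verts T1 &, injective f} -> f (root T1) = root T2 ->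
  {in verts T1 &, forall x y, adj (f x) (f y) = adj x y} ->
  {in verts T1 &, forall x y, arc (f x) (f y) = arc x y}.
Proof.
move=> rt1 rt2 fI fr fa.
have [r1 aV1 n1 u1 c1] := rt1; have [r2 aV2 n2 u2 c2] := rt2.
have H x y : arc x y -> arc (f x) (f y).
  move=> xy; have [xV yV] := aV1 _ _ xy.
  case/connectP: (c1 _ xV) => p; elim/last_ind: p x y xy xV yV
    => [|p z IH] x y xy xV yV.
    move=> _ /= ex; have /orP[//|] : adj (f x) (f y) by rewrite fa // /adj /= xy.
    by rewrite ex fr (negPf (n2 _)).
  rewrite rcons_path last_rcons => /andP[pp wz] ex; rewrite -{}ex in wz.
  set w := last _ _ in wz; have [wV _] := aV1 _ _ wz.
  have fwx : arc (f w) (f x) by exact: IH wz wV xV pp _.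
  have /orP[//|fyx] : adj (f x) (f y) by rewrite fa // /adj /= xy.
  have eyw : y = w by apply: fI => //; exact: u2 fyx fwx.
  by have := arc_asym rt1 wz; rewrite -eyw xy.
move=> x y xV yV; apply/idP/idP; last exact: H.
move=> fxy; have /orP[//|/H fyx] : adj x y by rewrite -fa // /adj /= fxy.
by have := arc_asym rt2 fxy; rewrite fyx.
Qed.

Lemma iso_vertex_code (T1 T2 : rtree) k : is_rooted_tree T1 -> is_rooted_tree T2 ->
  iso T1 T2 -> vertex_code k (root T1) = vertex_code k (root T2).
Proof.
move=> rt1 rt2 [f [g [fP gP fr r1 fa]]].
have fI : {in verts T1 &, injective f}.
  by move=> x y /fP[_ {2}<-] /fP[_ {2}<-] ->.
have arcE := iso_arc rt1 rt2 fI fr fa.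
rewrite -fr; apply/esym; apply: vertex_code_eq => //.
  by move=> x /fP[].
move=> x xV; apply/setP=> y; apply/setIdP/imsetP.
  case=> /gP[gy fgy] xy; exists (g y); rewrite // inE gy /=.
  by rewrite -arcE // fgy.
case=> w /setIdP[wV xw] ->; rewrite arcE //; split=> //.
by case: (fP _ wV).
Qed.

Lemma iso_code s t : iso (tree_of s) (tree_of t) <-> code s = code t.
Proof.
split=> [i|].
  (* Any depth above both heights makes [vertex_code] at the root equal to [code] in both trees. *)
  set k := (maxn (height s) (height t)).+1.
  rewrite -(@vertex_code_tree_of s k) ?ltnS ?leq_maxl //.
  rewrite -(@vertex_code_tree_of t k) ?ltnS ?leq_maxr //.
  exact: iso_vertex_code (tree_of_rooted s) (tree_of_rooted t) i.
elim: s t => [|a IHa b IHb] [|c d] //=.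
- move=> _; exists id, id; split=> //; exact: tree_of_verts.
- by move=> e; have := pair_code_gt0 (code c) (code d); rewrite -e.
- by move=> e; have := pair_code_gt0 (code a) (code b); rewrite e.
case/pair_code_inj=> -[e1 e2].
  by apply: iso_join; [exact: IHa | exact: IHb].
(* The codes of the branches agree crosswise, so the branches of the target are swapped first. *)
apply: (@iso_trans (join (tree_of d) (tree_of c))).
by apply: iso_join; [exact: IHa|exact: IHb].
by apply: iso_joinC; exact: tree_of_verts.
Qed.

Lemma isomorphic_leaf_induced s (L L' : {set ambient (tree_of s)}) :
  L != set0 -> L \subset leaves (tree_of s) ->
  L' != set0 -> L' \subset leaves (tree_of s) ->
  isomorphic (leaf_induced L) (leaf_induced L') =
    (code (shape L) == code (shape L')).
Proof.
move=> L0 Ll L0' Ll'; have i := leaf_induced_shape L0 Ll.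
have i' := leaf_induced_shape L0' Ll'.
have iP := isomorphicP (leaf_induced L') (iso_root i).
apply/idP/eqP => [/iP H|/iso_code H].
  apply/iso_code; apply: iso_trans i'; exact: iso_trans (iso_sym i) H.
by apply/iP; apply: iso_trans (iso_sym i'); exact: iso_trans i H.
Qed.

(** * Counting *)

Fixpoint codes (s : bintree) : seq nat :=
  if s is Nd a b then
    codes a ++ codes b ++ [seq pair_code x y | x <- codes a, y <- codes b]
  else [:: 0].

Definition leaf_sets (T : rtree) := [set L in powerset (leaves T) | L != set0].

Lemma leaf_setsP T (L : {set ambient T}) :
  reflect (L != set0 /\ L \subset leaves T) (L \in leaf_sets T).
Proof. by rewrite !inE andbC; exact: andP. Qed.

Lemma codesP s c :
  reflect (exists2 L : {set ambient (tree_of s)},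
             L \in leaf_sets (tree_of s) & code (@shape s L) = c)
          (c \in codes s).
Proof.
apply: (iffP idP).
  elim: s c => [|a IHa b IHb] c /=.
    rewrite inE => /eqP->; exists setT => //; apply/(@leaf_setsP point).
    split; first by apply/set0Pn; exists tt; rewrite inE.
    apply/subsetP=> x _; rewrite !inE cards_eq0; apply/eqP/setP=> y.
    by rewrite !inE.
  have dl := join_down_l (tree_of a) (tree_of b).
  have dr := join_down_r (tree_of a) (tree_of b).
  set il := fun _ => _ in dl; set ir := fun _ => _ in dr.
  (* A set of leaves with prescribed traces on the two branches; an empty trace yields the codes
     coming from a single branch. *)
  have pl (L1 : {set ambient (tree_of a)}) (L2 : {set ambient (tree_of b)}) :
      il @^-1: (il @: L1 :|: ir @: L2) = L1.
    apply/setP=> x; rewrite !inE mem_imset; last exact: embed_inj dl.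
    by case: imsetP => [[]//|]; rewrite orbF.
  have pr (L1 : {set ambient (tree_of a)}) (L2 : {set ambient (tree_of b)}) :
      ir @^-1: (il @: L1 :|: ir @: L2) = L2.
    apply/setP=> x; rewrite !inE mem_imset; last exact: embed_inj dr.
    by case: imsetP => [[]//|].
  have sub (L1 : {set ambient (tree_of a)}) (L2 : {set ambient (tree_of b)}) :
      L1 \subset leaves (tree_of a) -> L2 \subset leaves (tree_of b) ->
      il @: L1 :|: ir @: L2 \subset leaves (tree_of (Nd a b)).
    move=> /subsetP s1 /subsetP s2; apply/subsetP=> x /setUP[]/imsetP[u uL ->].
      by rewrite (embed_leaves dl) s1.
    by rewrite (embed_leaves dr) s2.
  rewrite !mem_cat => /or3P[/IHa[L /leaf_setsP[L0 Ll] <-]|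
    /IHb[L /leaf_setsP[L0 Ll] <-]|].
  - exists (il @: L :|: ir @: set0); last first.
      by rewrite /= -/il -/ir pl pr eqxx (negPf L0).
    apply/(@leaf_setsP (tree_of (Nd a b))); split; last by apply: sub; rewrite ?sub0set.
    apply: contraNneq L0 => e; rewrite -(pl L set0) e.
    by apply/eqP/setP=> x; rewrite !inE.
  - exists (il @: set0 :|: ir @: L); last first.
      by rewrite /= -/il -/ir pl pr eqxx.
    apply/(@leaf_setsP (tree_of (Nd a b))); split; last by apply: sub; rewrite ?sub0set.
    apply: contraNneq L0 => e; rewrite -(pr set0 L) e.
    by apply/eqP/setP=> x; rewrite !inE.
  case/allpairsP=> -[x y] /= [/IHa[L /leaf_setsP[L0 Ll] <-]].
  move=> /IHb[M /leaf_setsP[M0 Ml] <-] ->.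
  exists (il @: L :|: ir @: M); last first.
    by rewrite /= -/il -/ir pl pr (negPf L0) (negPf M0).
  apply/(@leaf_setsP (tree_of (Nd a b))); split; last exact: sub.
  apply: contraNneq L0 => e; rewrite -(pl L M) e.
  by apply/eqP/setP=> z; rewrite !inE.
case=> L + <-; elim: s L => [|a IHa b IHb] L; first by rewrite inE.
case/leaf_setsP=> L0 Ll /=; set L1 := _ @^-1: L; set L2 := _ @^-1: L.
have Ll1 : L1 \subset leaves (tree_of a).
  apply/subsetP=> l; rewrite inE => /(subsetP Ll).
  by rewrite (embed_leaves (join_down_l (tree_of a) (tree_of b))).
have Ll2 : L2 \subset leaves (tree_of b).
  apply/subsetP=> l; rewrite inE => /(subsetP Ll).
  by rewrite (embed_leaves (join_down_r (tree_of a) (tree_of b))).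
rewrite !mem_cat; case: eqP => [e1|/eqP n1].
  apply/or3P; apply: Or32; apply: IHb; apply/leaf_setsP; split=> //.
  apply: contraNneq L0 => e2; apply/eqP/setP=> -[[x|x]|]; rewrite inE.
  - by move/setP/(_ x): e1; rewrite !inE.
  - by move/setP/(_ x): e2; rewrite !inE.
  apply/negbTE; apply: (contraNN (subsetP Ll _)).
  by apply: join_root_notin_leaves; exact: tree_of_verts.
have m1 : code (shape L1) \in codes a by apply: IHa; apply/leaf_setsP.
case: eqP => [e2|/eqP n2]; first by rewrite m1.
apply/or3P; apply: Or33; apply/allpairsP; exists (code (shape L1), code (shape L2)).
by split=> //; apply: IHb; apply/leaf_setsP.
Qed.

(** Lets equivalence classes be counted by their codes: the number of values of a map on a list
    depends only on which entries it identifies. *)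
Lemma size_undup_map (T A B : eqType) (f : T -> A) (g : T -> B) s :
  {in s &, forall x y, (f x == f y) = (g x == g y)} ->
  size (undup (map f s)) = size (undup (map g s)).
Proof.
elim: s => //= x s IH fg.
have -> : (f x \in map f s) = (g x \in map g s).
  apply/mapP/mapP => -[y ys /eqP e]; exists y => //; apply/eqP; move: e;
    by rewrite fg // inE ?eqxx // ys orbT.
case: ifP => _ /=; rewrite IH // => y z ys zs;
  by apply: fg; rewrite inE ?ys ?zs orbT.
Qed.

Lemma num_leaf_induced_tree_of s :
  num_leaf_induced (tree_of s) = size (undup (codes s)).
Proof.
rewrite /num_leaf_induced -/(leaf_sets (tree_of s)) /equivalence_partition.
set f := fun x => _; pose D := leaf_sets (tree_of s); rewrite -/D.
have -> : #|f @: D| = size (undup (map f (enum D))).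
  rewrite cardE; apply: perm_size; apply: uniq_perm; rewrite ?enum_uniq ?undup_uniq //.
  move=> x; rewrite mem_enum mem_undup; apply/imsetP/mapP => -[y yD ->];
    by exists y; rewrite ?mem_enum // -mem_enum.
rewrite (@size_undup_map _ _ _ f (fun L => code (shape L))).
  apply: perm_size; apply: uniq_perm; rewrite ?undup_uniq // => c.
  rewrite !mem_undup; apply/mapP/codesP => [[L LD ->]|[L LD <-]].
    by exists L; rewrite // -mem_enum.
  by exists L; rewrite ?mem_enum.
move=> L M; rewrite !mem_enum => LD MD.
have [[L0 Ll] [M0 Ml]] := (leaf_setsP _ LD, leaf_setsP _ MD).
have fE (X Y : {set ambient (tree_of s)}) : X \in D ->
    (Y \in f X) = (Y \in D) && (code (shape X) == code (shape Y)).
  move=> XD; rewrite inE; case YD: (Y \in D) => //=.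
  have [[X0 Xl] [Y0 Yl]] := (leaf_setsP _ XD, leaf_setsP _ YD).
  exact: isomorphic_leaf_induced.
move: f fE => f fE.
apply/eqP/eqP => [|e]; last by apply/setP=> X; rewrite !fE // e.
by move/setP/(_ M); rewrite !fE // eqxx andbT MD => /eqP.
Qed.

Lemma codes0 s : 0 \in codes s.
Proof. by elim: s => //= a IHa b _; rewrite mem_cat IHa. Qed.

Definition num_codes s := size (undup (codes s)).

Lemma num_codes_le a b : num_codes (Nd a b) <=
  num_codes a + num_codes b + num_codes a * num_codes b.
Proof.
rewrite /num_codes -(size_allpairs pair_code) -addnA -!size_cat.
apply: uniq_leq_size (undup_uniq _) _ => c.
rewrite mem_undup /= !mem_cat !mem_undup => /or3P[->|->|] //; rewrite ?orbT //.
case/allpairsP=> -[x y] /= [xa yb ->]; apply/or3P; apply: Or33.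
by apply/allpairsP; exists (x, y); rewrite !mem_undup.
Qed.

(* The codes counted are those of the single leaf, of the joins of two equal
   trees, and of the joins of two trees only one of which occurs in b. *)
Lemma num_codes_ge a b : {subset codes b <= codes a} ->
  1 + num_codes b + (num_codes a - num_codes b) * num_codes b
    <= num_codes (Nd a b).
Proof.
move=> ba; set A := undup (codes a); set B := undup (codes b).
have uA : uniq A := undup_uniq _; have uB : uniq B := undup_uniq _.
have BA : {subset B <= A} by move=> x; rewrite !mem_undup; exact: ba.
pose C := [seq x <- A | x \notin B].
have sC : size C = num_codes a - num_codes b.
  apply: (@addnI (size B)); rewrite subnKC; last exact: uniq_leq_size.
  have -> : size B = count (mem B) A.
    rewrite -size_filter; apply: perm_size; apply: uniq_perm; rewrite ?filter_uniq //.
    by move=> x; rewrite mem_filter /= andb_idr //; exact: BA.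
  by rewrite size_filter count_predC.
pose l := 0 :: [seq pair_code y y | y <- B] ++ [seq pair_code x y | x <- C, y <- B].
suff ul : uniq l.
  have <- : size l = 1 + num_codes b + (num_codes a - num_codes b) * num_codes b.
    by rewrite /= size_cat size_map size_allpairs sC.
  apply: uniq_leq_size ul _ => c; rewrite inE mem_cat mem_undup.
  case/or3P => [/eqP->|/mapP[y yB ->]|/allpairsP[[x y] /= [xC yB ->]]].
  - exact: codes0.
  - rewrite /= !mem_cat; apply/or3P; apply: Or33; apply/allpairsP; exists (y, y).
    by move: yB; rewrite mem_undup => yB; split=> //; exact: ba.
  rewrite /= !mem_cat; apply/or3P; apply: Or33; apply/allpairsP; exists (x, y).
  by move: xC yB; rewrite mem_filter !mem_undup => /andP[_ xA] yB.
rewrite /= mem_cat cat_uniq; apply/and4P; split.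
- apply/norP; split; apply/negP.
    by case/mapP=> y _ e; have := pair_code_gt0 y y; rewrite -e.
  by case/allpairsP=> -[x y] [_ _ e]; have := pair_code_gt0 x y; rewrite -e.
- by rewrite map_inj_in_uniq // => x y _ _ /pair_code_inj[][].
- apply/hasPn => c /allpairsP[[x y] /= [+ yB ->]]; rewrite mem_filter => /andP[xB _].
  apply: contra xB => /mapP[z zB /pair_code_inj[][-> _]]; exact: zB.
(* An unordered pair with exactly one entry in [B] determines the ordered pair, so these codes are
   distinct. *)
apply: allpairs_uniq => //; first exact: filter_uniq.
move=> [x y] [x' y'] /allpairsP[[x1 y1] /= [xC yB [-> ->]]].
case/allpairsP=> [[x2 y2] /= [xC' yB' [-> ->]]].
case/pair_code_inj=> -[-> ey]; first by rewrite ey.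
by move: xC'; rewrite mem_filter -ey yB.
Qed.

(** * Bounds for the leaf-Fibonacci trees *)

Fixpoint fib_shape (n : nat) : bintree :=
  match n with
  | 0 => Lf
  | 1 => Nd Lf Lf
  | (m.+1 as k).+1 => Nd (fib_shape k) (fib_shape m)
  end.

Lemma leaf_fibonacci_tree_of n : leaf_fibonacci n = tree_of (fib_shape n).
Proof.
suff [] : leaf_fibonacci n = tree_of (fib_shape n) /\
          leaf_fibonacci n.+1 = tree_of (fib_shape n.+1) by [].
by elim: n => [|n [e e']]; split=> //; rewrite [RHS]/= -e -[tree_of _]e'.
Qed.

(** The first branch of [fib_shape n.+1] is [fib_shape n], and [codes] of a node starts with the
    codes of its first branch. *)
Lemma codes_fib_sub n : {subset codes (fib_shape n) <= codes (fib_shape n.+1)}.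
Proof.
move=> c cn.
have [t ->] : exists t, codes (fib_shape n.+1) = codes (fib_shape n) ++ t.
  by case: n {cn} => [|n]; eexists.
by rewrite mem_cat cn.
Qed.

Definition num_fib n := num_leaf_induced (leaf_fibonacci n).

Lemma num_fibE n : num_fib n = num_codes (fib_shape n).
Proof. by rewrite /num_fib leaf_fibonacci_tree_of num_leaf_induced_tree_of. Qed.

Lemma num_fib_le n :
  num_fib n.+2 <= num_fib n.+1 + num_fib n + num_fib n.+1 * num_fib n.
Proof. by rewrite !num_fibE; exact: num_codes_le. Qed.

Lemma num_fib_ge n :
  1 + num_fib n + (num_fib n.+1 - num_fib n) * num_fib n <= num_fib n.+2.
Proof. by rewrite !num_fibE; apply: num_codes_ge; exact: codes_fib_sub. Qed.

Lemma num_fib0 : num_fib 0 = 1.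
Proof. by rewrite num_fibE. Qed.

Lemma num_fib1 : num_fib 1 = 2.
Proof. by rewrite num_fibE. Qed.

(** If [b >= 2 * a] then [b - a] is at least half of [b], so with [a >= 4] the lower bound
    [(b - a) * a] for the next term is at least [2 * b]. The first step has only [a >= 3] and
    [b >= 2 * a - 1], where the summand [1 + a] makes up the difference. *)
Lemma num_fib_double n : 4 <= num_fib n.+3 /\ 2 * num_fib n.+3 <= num_fib n.+4.
Proof.
elim: n => [|n [h4 h2]].
  have := num_fib_ge 0; have := num_fib_ge 1; have := num_fib_ge 2.
  rewrite num_fib0 num_fib1.
  move: (num_fib 2) (num_fib 3) (num_fib 4) => a b c hc hb ha.
  have {}ha : 3 <= a by [].
  have {}hb : 2 * a <= b.+1 by lia.
  have : (b - a) * 3 <= (b - a) * a by rewrite leq_mul2l ha orbT.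
  lia.
have := num_fib_ge n.+3; move: (num_fib n.+3) (num_fib n.+4) (num_fib n.+4.+1) h4 h2.
move=> a b c h4 h2 hc.
have : (b - a) * 4 <= (b - a) * a by rewrite leq_mul2l h4 orbT.
lia.
Qed.

Lemma num_fib_large n : 4 * 2 ^ n <= num_fib n.+3.
Proof.
elim: n => [|n IH]; first by case: (num_fib_double 0).
case: (num_fib_double n) => _; apply: leq_trans.
by rewrite expnS mulnCA leq_mul2l.
Qed.

From mathcomp Require Import all_boot all_order all_algebra.
From mathcomp Require Import all_classical all_reals all_analysis.
From mathcomp Require Import ring lra zify.
Import Order.TTheory GRing.Theory Num.Theory.
Import numFieldNormedType.Exports.

Local Open Scope classical_set_scope.
Local Open Scope ring_scope.

(** * Asymptotics *)

Lemma contracting_recurrence (R : realType) (t : R) (d r : nat -> R) :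
  `|t| < 1 -> (forall n, d n.+1 = t * d n + r n) ->
  r n @[n --> \oo] --> 0 -> d n @[n --> \oo] --> 0.
Proof.
move=> t1 dE /cvgr0Pnorm_le r0; apply/cvgr0Pnorm_le => eps eps0.
have e2 : 0 < eps / 2 by rewrite divr_gt0.
have t2 : 0 < 1 - `|t| by rewrite subr_gt0.
(* This threshold makes [eps / 2] a fixed point of the affine bound: multiplied by the norm of [t]
   and increased by the threshold, it is [eps / 2] again. *)
have [N _ rN] := r0 (eps / 2 * (1 - `|t|)) (mulr_gt0 e2 t2).
have dN k : `|d (k + N)%N| <= `|t| ^+ k * `|d N| + eps / 2.
  elim: k => [|k IH]; first by rewrite expr0 mul1r lerDl ltW // divr_gt0.
  rewrite addSn dE (le_trans (ler_normD _ _)) // normrM exprS.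
  have := rN _ (leq_addl k N); rewrite /= => rk.
  have := ler_wpM2l (normr_ge0 t) IH; nra.
have tk : geometric `|d N| `|t| n @[n --> \oo] --> 0.
  by apply: cvg_geometric; rewrite normr_id.
have [M _ tM] := (cvgr0Pnorm_le _).1 tk _ e2.
exists (M + N)%N => //= n MNn; have Nn := leq_trans (leq_addl _ _) MNn.
have := dN (n - N)%N; rewrite subnK // => /le_trans; apply.
have := tM (n - N)%N; rewrite /= leq_subRL // addnC => /(_ MNn).
rewrite normrM normrX !normr_id; lra.
Qed.

(** The rescaled sequence [x n / phi ^+ n] has increments dominated by a geometric series, so it
    tends to some [B]. Its distance to [B] is [o(phi ^- n)], since [e] tends to 0, and scaling back
    leaves an error [o(1)]. *)
Lemma expanding_recurrence (R : realType) (phi : R) (x e : nat -> R) :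
  1 < phi -> (forall n, x n.+1 = phi * x n + e n) ->
  e n @[n --> \oo] --> 0 ->
  exists B, x n - B * phi ^+ n @[n --> \oo] --> 0.
Proof.
move=> phi1 xE e0; have phi0 : 0 < phi by apply: lt_trans phi1.
set t := phi^-1; have t0 : 0 < t by rewrite invr_gt0.
have t1 : t < 1 by rewrite invf_lt1.
have pt : phi * t = 1 by rewrite divff ?gt_eqF.
pose y n := x n * t ^+ n.
have yE n : y n.+1 = y n + e n * t ^+ n.+1.
  rewrite /y xE !exprS.
  transitivity ((phi * t) * x n * t ^+ n + e n * (t * t ^+ n)); first by ring.
  by rewrite pt mul1r.
have [M Mgt0 eM] : exists2 M, 0 < M & forall n, `|e n| <= M.
  have /cvg_seq_bounded[M [_ eM]] : cvgn e by apply/cvg_ex; exists 0.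
  exists (`|M| + 1); first by rewrite ltr_wpDl.
  by move=> n; apply: eM => //; rewrite (le_lt_trans (ler_norm M)) // ltrDl.
have cs : cvgn (series (fun n => e n * t ^+ n.+1)).
  apply: normed_cvg.
  apply: (@series_le_cvg _ _ (geometric M t)) => [n|n|n|] /=.
  - exact: normr_ge0.
  - by rewrite mulr_ge0 ?exprn_ge0 // ltW.
  - rewrite normrM; apply: ler_pM => //; rewrite normrX (ger0_norm (ltW t0)) exprS.
    by rewrite ler_piMl ?exprn_ge0 // ltW.
  - by apply: is_cvg_geometric_series; rewrite (ger0_norm (ltW t0)).
have [B yB] : exists B : R, y n @[n --> \oo] --> B.
  have yS n : y n = y 0%N + series (fun n => e n * t ^+ n.+1) n.
    elim: n => [|n IH]; first by rewrite /series /= big_geq // addr0.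
    by rewrite yE IH seriesSr addrA.
  exists (y 0%N + lim (series (fun n => e n * t ^+ n.+1) @ \oo)).
  under eq_fun do rewrite yS.
  by apply: cvgD cs; exact: cvg_cst.
exists B; apply/cvgr0Pnorm_le => eps eps0.
have p2 : 0 < phi - 1 by rewrite subr_gt0.
(* The factor [phi - 1] makes the tail telescope: [(phi - 1) * t ^+ j.+1 = t ^+ j - t ^+ j.+1]. *)
have [N _ eN] := (cvgr0Pnorm_le _).1 e0 _ (mulr_gt0 eps0 p2).
exists N => //= n Nn.
have yk k : `|y (k + n)%N - y n| <= eps * (t ^+ n - t ^+ (k + n)).
  elim: k => [|k IH]; first by rewrite add0n !subrr normr0 mulr0.
  rewrite addSn yE addrAC (le_trans (ler_normD _ _)) // normrM normrX.
  rewrite (ger0_norm (ltW t0)).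
  have := eN (k + n)%N (leq_trans Nn (leq_addl _ _)); rewrite /= => ek.
  have tk : 0 <= t ^+ (k + n).+1 by rewrite exprn_ge0 // ltW.
  have tE : t ^+ (k + n) = phi * t ^+ (k + n).+1 by rewrite exprS mulrA pt mul1r.
  have := ler_wpM2r tk ek; move: IH; rewrite tE.
  move: (t ^+ (k + n).+1) => s; move: (`|_ - _|) (`|e _| * s) => u v; lra.
have By : `|B - y n| <= eps * t ^+ n.
  have cB : `|y (k + n)%N - y n| @[k --> \oo] --> `|B - y n|.
    apply: cvg_norm; apply: cvgB; last exact: cvg_cst.
    by rewrite -(cvg_shiftn n) in yB.
  rewrite -(cvg_lim _ cB) //; apply: limr_le; first by apply/cvg_ex; eexists; exact: cB.
  near=> k; apply: (le_trans (yk k)).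
  by rewrite ler_pM2l // gerBl exprn_ge0 // ltW.
have -> : x n - B * phi ^+ n = (y n - B) * phi ^+ n.
  by rewrite mulrBl /y -mulrA -exprMn [t * _]mulrC pt expr1n mulr1.
rewrite normrM distrC normrX (ger0_norm (ltW phi0)).
have := ler_wpM2r (exprn_ge0 n (ltW phi0)) By.
by rewrite -mulrA -exprMn [t * _]mulrC pt expr1n mulr1.
Unshelve. all: by end_near. Qed.

Lemma fibonacci_recurrence (R : realType) (a e : nat -> R) :
  (forall n, a n.+2 = a n.+1 + a n + e n) -> e n @[n --> \oo] --> 0 ->
  exists c, a n - c * ((1 + Num.sqrt 5) / 2) ^+ n @[n --> \oo] --> 0.
Proof.
move=> aE e0; set s : R := Num.sqrt 5; set phi := (1 + s) / 2.
have s2 : s ^+ 2 = 5 by rewrite sqr_sqrtr.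
have s0 : 0 <= s by exact: sqrtr_ge0.
(* The bounds [2 < s < 3] suffice for [1 < phi] and for [psi] to lie strictly between [-1] and
   [1]. *)
have s_gt2 : 2 < s by rewrite expr2 in s2; nra.
have s_lt3 : s < 3 by rewrite expr2 in s2; nra.
pose psi := (1 - s) / 2.
have phi1 : 1 < phi by rewrite /phi; lra.
have ppsi : phi * psi = -1.
  have -> : phi * psi = (1 - s ^+ 2) / 4 by rewrite /phi /psi; field.
  by rewrite s2; field.
(* The recurrence factors because [phi + psi = 1] and [phi * psi = -1]. *)
have xE n : a n.+2 - psi * a n.+1 = phi * (a n.+1 - psi * a n) + e n.
  have -> : phi * (a n.+1 - psi * a n) = phi * a n.+1 - (phi * psi) * a n by ring.
  by rewrite aE ppsi /psi /phi; field.
have [B xB] := @expanding_recurrence _ phi (fun n => a n.+1 - psi * a n) e phi1 xE e0.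
(* Since [phi - psi = s], subtracting [(B / s) * phi ^+ n] from [a n] leaves a sequence that
   satisfies the recurrence with factor [psi] and error [a n.+1 - psi * a n - B * phi ^+ n]. *)
exists (B / s); apply: contracting_recurrence (_ : `|psi| < 1) _ xB.
  by rewrite ltr_norml /psi; apply/andP; split; lra.
have sn0 : s != 0 by rewrite gt_eqF //; lra.
move=> n; rewrite /= exprS; move: (phi ^+ n) => q; by rewrite /phi /psi; field.
Qed.

(** * Growth of the number of leaf-induced subtrees *)

Lemma num_fib_gt0 n : (0 < num_fib n)%N.
Proof.
rewrite num_fibE /num_codes; have := codes0 (fib_shape n).
by rewrite -mem_undup; case: undup.
Qed.

Section Growth.
Variable R : realType.
Let u n : R := (num_fib n)%:R.

Let u_gt0 n : 0 < u n.
Proof. by rewrite ltr0n num_fib_gt0. Qed.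

Lemma num_fib_inv_cvg : (u n)^-1 @[n --> \oo] --> 0.
Proof.
rewrite -(cvg_shiftn 3).
apply: (@squeeze_cvgr _ _ _ _ (fun=> 0) (geometric 1 (1 / 2))); last 2 first.
- exact: cvg_cst.
- by apply: cvg_geometric; rewrite ger0_norm; lra.
near=> n; rewrite invr_ge0 ltW //= mul1r div1r exprVn lef_pV2 ?posrE ?exprn_gt0 //.
rewrite addn3 /u -natrX ler_nat (leq_trans _ (num_fib_large n)) //.
by rewrite leq_pmull.
Unshelve. all: by end_near. Qed.

(** By doubling, [u n.+1 - u n] is at least half of [u n.+1] from index 3 on, so the lower bound
    gives [u n.+2 >= u n.+1 * u n / 2], that is, [u n.+1 / u n.+2 <= 2 / u n]. *)
Lemma num_fib_ratio_cvg : u n / u n.+1 @[n --> \oo] --> 0.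
Proof.
rewrite -(cvg_shiftn 4).
apply: (@squeeze_cvgr _ _ _ _ (fun=> 0) (fun n => 2 * (u (n + 3))^-1)).
- near=> n; apply/andP; split; first by rewrite divr_ge0 // ltW.
  rewrite /= addn3 addn4 ler_pdivrMr // mulrAC ler_pdivlMr //.
  case: (num_fib_double n) => _ h2; have hge := num_fib_ge n.+3.
  rewrite /u -!natrM ler_nat.
  move: (num_fib n.+3) (num_fib n.+4) (num_fib n.+4.+1) h2 hge => a b c h2 hge.
  have ab : (a * b <= 2 * ((b - a) * a))%N.
    by rewrite [leqRHS]mulnA [(2 * _ * _)%N]mulnC leq_mul2l; apply/orP; right; lia.
  have := leq_trans ab (leq_mul (leqnn 2) (leq_trans (leq_addl _ _) hge)).
  by rewrite [(b * a)%N]mulnC.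
- exact: cvg_cst.
- rewrite -[X in _ --> X](mulr0 (2 : R)); apply: cvgM; first exact: cvg_cst.
  by have := num_fib_inv_cvg; rewrite -(cvg_shiftn 3).
Unshelve. all: by end_near. Qed.

(** Dividing [num_fib_ge] and [num_fib_le] by [u n.+1 * u n] squeezes the quotient between two
    sequences tending to 1. *)
Lemma num_fib_quotient_cvg : u n.+2 / (u n.+1 * u n) @[n --> \oo] --> (1 : R).
Proof.
apply: (@squeeze_cvgr _ _ _ _ (fun n => 1 - u n / u n.+1)
          (fun n => 1 + ((u n)^-1 + (u n.+1)^-1))).
- near=> n; have u0 := u_gt0 n; have u1 := u_gt0 n.+1.
  have u10 : 0 < u n.+1 * u n by rewrite mulr_gt0.
  apply/andP; split.
    rewrite ler_pdivlMr //.
    have -> : (1 - u n / u n.+1) * (u n.+1 * u n) = (u n.+1 - u n) * u n.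
      by field; rewrite gt_eqF.
    have := num_fib_ge n; rewrite -(ler_nat R) natrD natrM => h.
    apply: le_trans h; rewrite -[leLHS]add0r.
    apply: lerD; first exact: ler0n.
    apply: ler_wpM2r; first exact: ltW.
    (* The truncated difference of natural numbers is at least the real one. *)
    rewrite lerBlDr -natrD ler_nat; lia.
  rewrite ler_pdivrMr //.
  have -> : (1 + ((u n)^-1 + (u n.+1)^-1)) * (u n.+1 * u n) =
            u n.+1 + u n + u n.+1 * u n.
    by field; rewrite !gt_eqF.
  by rewrite /u -!natrM -!natrD ler_nat num_fib_le.
- rewrite -[X in _ --> X](subr0 (1 : R)); apply: cvgB; first exact: cvg_cst.
  exact: num_fib_ratio_cvg.
- rewrite -[X in _ --> X](addr0 (1 : R)) -[X in _ + X](addr0 (0 : R)).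
  apply: cvgD; first exact: cvg_cst.
  apply: cvgD; first exact: num_fib_inv_cvg.
  by have := num_fib_inv_cvg; rewrite -cvg_shiftS.
Unshelve. all: by end_near. Qed.

End Growth.

Theorem mainTheorem3 (R : realType) :
  exists K1 K2 : R, [/\ 0 < K1, 0 < K2 &
    exists2 eps : nat -> R, eps n @[n --> \oo] --> 0 &
      forall n : nat,
        (num_leaf_induced (leaf_fibonacci n))%:R =
        (1 + eps n) * K1 * K2 `^ (((1 + Num.sqrt 5) / 2) ^+ n)].
Proof.
pose u n : R := (num_fib n)%:R; have u0 n : 0 < u n by rewrite ltr0n num_fib_gt0.
pose e n := ln (u n.+2 / (u n.+1 * u n)).
have e0 : e n @[n --> \oo] --> 0.
  rewrite -(ln1 R); apply: (continuous_cvg _ (continuous_ln ltr01)).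
  exact: num_fib_quotient_cvg.
have aE n : ln (u n.+2) = ln (u n.+1) + ln (u n) + e n.
  by rewrite /e ln_div ?posrE ?mulr_gt0 // lnM ?posrE // addrC subrK.
have [c ac] := @fibonacci_recurrence R (fun n => ln (u n)) e aE e0.
exists 1, (expR c); split; rewrite ?ltr01 ?expR_gt0 //.
(* Here [1 + eps n] is the exponential of the error in [ln (u n)], so the equation is exact for
   every [n], and [eps] tends to 0 by continuity of [expR] at 0. *)
exists (fun n => expR (ln (u n) - c * ((1 + Num.sqrt 5) / 2) ^+ n) - 1).
  have := continuous_cvg _ (@continuous_expR R 0) ac.
  rewrite expR0 => /(_ _) ec; have := cvgB ec (cvg_cst (1 : R)).
  by rewrite subrr; apply.
by move=> n; rewrite addrC subrK mulr1 -expRM -expRD subrK lnK ?posrE.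
Qed.
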